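(* Let $\sigma>0$ and suppose that both $\Sigma_{f_1}+B_1^*B_1+\mathcal{T}_1$ and $\Sigma_{f_2}+B_2^*B_2+\mathcal{T}_2$ are positive definite. Consider the operators $\mathcal{T}:\mathbb{W}\to2^{\mathbb{W}}$ and $\mathcal{M}:\mathbb{W}\to\mathbb{W}$ defined in the context. Then the sequence $\{w^k\}$ generated by the preconditioned ADMM (pADMM) described in the context coincides with the sequence $\{w^k\}$ generated by the degenerate proximal point method (dPPM) $$w^{k+1}=(1-\rho_k)w^k+\rho_k\bar w^k,\qquad \bar w^k=(\mathcal{M}+\mathcal{T})^{-1}\mathcal{M}w^k,\qquad k=0,1,\ldots,$$ with the same initial point $w^0\in\mathbb{W}$ and the same relaxation factors $\rho_k\in(0,2]$. Additionally, $\mathcal{M}$ is an admissible preconditioner for $\mathcal{T}$ such that $(\mathcal{M}+\mathcal{T})^{-1}$ is Lipschitz continuous.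
   Context: Setting. $\mathbb{X},\mathbb{Y},\mathbb{Z}$ are finite-dimensional real Euclidean spaces, $\mathbb{W}:=\mathbb{Y}\times\mathbb{Z}\times\mathbb{X}$, $w=(y,z,x)$. $f_1:\mathbb{Y}\to(-\infty,+\infty]$ and $f_2:\mathbb{Z}\to(-\infty,+\infty]$ are proper closed convex functions, $B_1:\mathbb{Y}\to\mathbb{X}$ and $B_2:\mathbb{Z}\to\mathbb{X}$ are linear with adjoints $B_1^*,B_2^*$, and $c\in\mathbb{X}$. The problem considered is $\min_{y,z} f_1(y)+f_2(z)$ subject to $B_1y+B_2z=c$. $\mathcal{T}_1$ and $\mathcal{T}_2$ are self-adjoint positive semidefinite linear operators on $\mathbb{Y}$ and $\mathbb{Z}$. For a self-adjoint positive semidefinite operator $\mathcal{S}$, $\|v\|_{\mathcal{S}}:=\sqrt{\langle v,\mathcal{S}v\rangle}$. $\Sigma_{f_1}$ and $\Sigma_{f_2}$ are self-adjoint positive semidefinite operators (which exist by convexity) such that for all $y,\hat y\in\operatorname{dom}(f_1)$, $\phi\in\partial f_1(y)$, $\hat\phi\in\partial f_1(\hat y)$: $f_1(y)\ge f_1(\hat y)+\langle\hat\phi,y-\hat y\rangle+\frac12\|y-\hat y\|^2_{\Sigma_{f_1}}$ and $\langle\phi-\hat\phi,y-\hat y\rangle\ge\|y-\hat y\|^2_{\Sigma_{f_1}}$; and similarly for $f_2$ and $\Sigma_{f_2}$ on $\mathbb{Z}$. Operators on $\mathbb{W}$: $$\mathcal{M}=\begin{bmatrix} \sigma B_1^*B_1+\mathcal{T}_1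 & 0 & B_1^* \\ 0 & \mathcal{T}_2 & 0 \\ B_1 & 0 & \sigma^{-1}\mathcal{I} \end{bmatrix},\qquad \mathcal{T}w=\begin{pmatrix} \partial f_1(y)+B_1^*x \\ \partial f_2(z)+B_2^*x \\ c-B_1y-B_2z \end{pmatrix},\quad w=(y,z,x)\in\mathbb{W},$$ where $\mathcal{I}$ is the identity. ($\mathcal{T}$ is maximal monotone.) Admissible preconditioner for $\mathcal{T}$: a linear, bounded, self-adjoint, positive semidefinite operator $\mathcal{M}$ such that $(\mathcal{M}+\mathcal{T})^{-1}\mathcal{M}$ is single-valued and has full domain. Augmented Lagrangian: $L_\sigma(y,z;x)=f_1(y)+f_2(z)+\langle x,B_1y+B_2z-c\rangle+\frac{\sigma}{2}\|B_1y+B_2z-c\|^2$. pADMM: from an initial point $w^0=(y^0,z^0,x^0)$ and with $\rho_k\in(0,2]$, for $k=0,1,\ldots$, with $\bar w^k=(\bar y^k,\bar z^k,\bar x^k)$: 1. $\bar z^k=\arg\min_{z\in\mathbb{Z}}\{L_\sigma(y^k,z;x^k)+\frac12\|z-z^k\|^2_{\mathcal{T}_2}\}$; 2. $\bar x^k=x^k+\sigma(B_1y^k+B_2\bar z^k-c)$; 3. $\bar y^k=\arg\min_{y\in\mathbb{Y}}\{L_\sigma(y,\bar z^k;\bar x^k)+\frac12\|y-y^k\|^2_{\mathcal{T}_1}\}$; 4. $w^{k+1}=(1-\rho_k)w^k+\rho_k\bar w^k$.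
   Formalization: In step 1 of pADMM the summand f_1(y^k) of L_σ(y^k,z;x^k), constant in z, is dropped: y^k may lie outside dom(f_1), where the literal objective is identically +∞ and has no unique minimizer; for y^k in dom(f_1) the argmin is unchanged. *)

(* Defs.v *)
From HB Require Import structures.
From mathcomp Require Import all_boot all_order all_algebra.
From mathcomp Require Import all_classical all_reals.

Set Implicit Arguments.
Unset Strict Implicit.
Unset Printing Implicit Defensive.

Import Order.TTheory GRing.Theory Num.Theory.
Local Open Scope classical_set_scope.
Local Open Scope ring_scope.


HB.mixin Record isEuclidean (R : realType) V of Vector R V := {
  edot : {dot V for idfun} }.

#[short(type="euclideanType")]
HB.structure Definition Euclidean (R : realType) :=
  { V of Vector R V & isEuclidean R V }.

Notation "''[' u , v ]" := (edot u v) : ring_scope.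

Definition enorm (R : realType) (U : euclideanType R) (v : U) : R :=
  Num.sqrt '[v, v].

Section ProductSpace.
Variables (R : realType) (U V : euclideanType R).

Definition prod_dot (p q : (U * V)%type) : R := '[p.1, q.1] + '[p.2, q.2].

Lemma prod_dot_bilinear :
  bilinear_for (GRing.Scale.Law.clone _ _ ( *%R ) _)
    (GRing.Scale.Law.clone _ _ (@idfun R \; *%R ) _) prod_dot.
Proof.
by split=> p a q r; rewrite /prod_dot /= ?(linearPl, linearP) /=
  mulrDr addrACA.
Qed.

HB.instance Definition _ := bilinear_isBilinear.Build R (U * V)%type
  (U * V)%type R ( *%R ) (@idfun R \; *%R ) prod_dot prod_dot_bilinear.

Lemma prod_dot_sym p q :
  prod_dot p q = (-1) ^+ false * idfun (prod_dot q p).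
Proof.
rewrite expr0 mul1r /= /prod_dot.
by rewrite [edot q.1 _]hermC [edot q.2 _]hermC /= !expr0 !mul1r.
Qed.

HB.instance Definition _ := isHermitianSesquilinear.Build R (U * V)%type
  false idfun prod_dot prod_dot_sym.

Lemma edot_ge0 (E : euclideanType R) (u : E) : 0 <= '[u, u].
Proof.
have [->|u0] := eqVneq u 0; first by rewrite linear0r.
exact/ltW/neq0_dnorm_gt0.
Qed.

Lemma prod_dot_gt0 p : p != 0 -> 0 < prod_dot p p.
Proof.
case: p => u v; rewrite /prod_dot /= => p0.
have [u0|u0] := eqVneq u 0; last first.
  by rewrite ltr_wpDr ?edot_ge0 //; exact: neq0_dnorm_gt0.
rewrite ltr_wpDl ?edot_ge0 //; apply: neq0_dnorm_gt0.
by apply: contraNneq p0 => ->; rewrite u0.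
Qed.

HB.instance Definition _ :=
  isDotProduct.Build R (U * V)%type prod_dot prod_dot_gt0.

HB.instance Definition _ := isEuclidean.Build R (U * V)%type
  (prod_dot : {dot (U * V)%type for idfun}).

End ProductSpace.


Lemma edotC (R : realType) (U : euclideanType R) (u v : U) : '[u, v] = '[v, u].
Proof. by rewrite hermC /= expr0 mul1r. Qed.

Lemma edot_inj (R : realType) (U : euclideanType R) (u v : U) :
  (forall w, '[w, u] = '[w, v]) -> u = v.
Proof.
move=> /(_ (u - v)) /eqP; rewrite -subr_eq0 -linearBr => /eqP e.
apply/eqP; rewrite -subr_eq0; apply: contraT.
by move=> /(@neq0_dnorm_gt0 _ _ _ edot); rewrite e ltxx.
Qed.

Section Riesz.
Variables (R : realType) (U : euclideanType R).

Definition riesz_fun (u : U) : 'Hom(U, R^o) := linfun (edot u : U -> R^o).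

Lemma riesz_funE u v : riesz_fun u v = '[u, v].
Proof. by rewrite lfunE. Qed.

Lemma riesz_fun_linear : linear riesz_fun.
Proof.
move=> a u v; apply/lfunP => w.
by rewrite !lfunE /= !lfunE /= !riesz_funE linearPl.
Qed.

HB.instance Definition _ :=
  GRing.isLinear.Build R U 'Hom(U, R^o) _ riesz_fun riesz_fun_linear.

Lemma riesz (g : 'Hom(U, R^o)) : exists u : U, forall v, g v = '[v, u].
Proof.
pose F := linfun riesz_fun.
have inj : lker F == 0%VS.
  apply/lker0P => u v; rewrite !lfunE /= => /lfunP uv.
  by apply: edot_inj => w; have := uv w; rewrite !riesz_funE edotC [RHS]edotC.
have full : limg F = fullv.
  apply/eqP; rewrite eqEdim subvf /= limg_dim_eq; last first.
    by rewrite (eqP inj) capv0.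
  by rewrite !dimvf /dim /= muln1.
have /memv_imgP[u _ gE] : g \in limg F by rewrite full memvf.
by exists u => v; rewrite gE lfunE /= riesz_funE edotC.
Qed.

End Riesz.

Section Operators.
Variable R : realType.

Lemma adjoint_exists (U V : euclideanType R) (B : 'Hom(U, V)) :
  exists Bs : 'Hom(V, U), forall u v, '[B u, v] = '[u, Bs v].
Proof.
have ex v : exists w : U, forall u, '[B u, v] = '[u, w].
  have [w wP] := riesz (riesz_fun v \o B)%VF.
  by exists w => u; rewrite -wP comp_lfunE riesz_funE edotC.
have [g gP] := choice ex.
have glin : linear g.
  move=> a v1 v2; apply: edot_inj => u.
  by rewrite -gP !linearP /= !gP.
pose gL := GRing.isLinear.Build R V U _ g glin.
pose G : {linear V -> U} := HB.pack g gL.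
by exists (linfun G) => u v; rewrite lfunE /= gP.
Qed.

Definition adjoint (U V : euclideanType R) (B : 'Hom(U, V)) : 'Hom(V, U) :=
  projT1 (cid (adjoint_exists B)).

Lemma adjointP (U V : euclideanType R) (B : 'Hom(U, V)) u v :
  '[B u, v] = '[u, adjoint B v].
Proof. exact: (projT2 (cid (adjoint_exists B))). Qed.

Definition self_adjoint (U : euclideanType R) (S : U -> U) :=
  forall u v, '[S u, v] = '[u, S v].

Definition pos_semidef (U : euclideanType R) (S : U -> U) :=
  forall v, 0 <= '[v, S v].

Definition pos_def (U : euclideanType R) (S : U -> U) :=
  self_adjoint S /\ forall v, v != 0 -> 0 < '[v, S v].

Definition bounded_op (U : euclideanType R) (S : U -> U) :=
  exists C : R, forall v, enorm (S v) <= C * enorm v.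

Definition snorm (U : euclideanType R) (S : U -> U) (v : U) : R :=
  Num.sqrt '[v, S v].

End Operators.


Section ConvexFunctions.
Variables (R : realType) (U : euclideanType R).
Implicit Type f : U -> \bar R.

Definition edom f : set U := [set u | (f u < +oo)%E].

Definition proper_fun f := (forall u, f u != -oo%E) /\ edom f !=set0.

(* For a proper function, closedness is lower semicontinuity. *)
Definition closed_fun f := forall u (a : R), (a%:E < f u)%E ->
  exists2 e : R, 0 < e & forall v, enorm (v - u) < e -> (a%:E < f v)%E.

Definition convex_fun f := forall u v (t : R), 0 <= t <= 1 ->
  (f (t *: u + (1 - t) *: v)%R <= t%:E * f u + (1 - t)%:E * f v)%E.

(* If f is proper, this is empty at every u outside the domain of f. *)
Definition subdiff f (u : U) : set U :=
  [set phi | forall v, (f u + ('[phi, v - u])%:E <= f v)%E].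

Definition argmin f : set U := [set u | forall v, (f u <= f v)%E].

Definition convexity_operator f (Sigma : 'End(U)) :=
  [/\ self_adjoint Sigma, pos_semidef Sigma &
   forall y yh phi phih, edom f y -> edom f yh ->
     subdiff f y phi -> subdiff f yh phih ->
     (f yh + ('[phih, y - yh] + 2^-1 * snorm Sigma (y - yh) ^+ 2)%:E <= f y)%E
     /\ snorm Sigma (y - yh) ^+ 2 <= '[phi - phih, y - yh]].

End ConvexFunctions.


Section SetValued.
Variables (R : realType) (U : euclideanType R).
Implicit Type F : U -> set U.

Definition inv_op F : U -> set U := fun v => [set u | F u v].

Definition single_valued F := forall v u1 u2, F v u1 -> F v u2 -> u1 = u2.

Definition full_domain F := forall v, F v !=set0.

(* (M + T)^-1 *)
Definition resolvent (M : U -> U) (T : U -> set U) : U -> set U :=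
  inv_op (fun u => [set M u + v | v in T u]).

Definition admissible_preconditioner (M : U -> U) (T : U -> set U) :=
  [/\ linear M, bounded_op M, self_adjoint M, pos_semidef M &
      single_valued (fun w => resolvent M T (M w)) /\
      full_domain (fun w => resolvent M T (M w))].

(* As a map from U to U: everywhere defined, single-valued and Lipschitz. *)
Definition lipschitz_op F :=
  [/\ full_domain F, single_valued F &
      exists L : R, forall v1 v2 u1 u2, F v1 u1 -> F v2 u2 ->
        enorm (u1 - u2) <= L * enorm (v1 - v2)].

(* The equality with a singleton states both that (M + T)^-1 (M w^k) has
   exactly one element and that this element is wb^k. *)
Definition dPPM (M : U -> U) (T : U -> set U) (rho : nat -> R) (w0 : U)
    (w wb : nat -> U) :=
  w 0%N = w0 /\
  forall k, resolvent M T (M (w k)) = [set wb k] /\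
    w k.+1 = (1 - rho k) *: w k + rho k *: wb k.

End SetValued.


Section ADMM.
Variables (R : realType) (Y Z X : euclideanType R).
Local Notation W := (Y * Z * X)%type.

Definition M_op (sigma : R) (B1 : 'Hom(Y, X)) (T1 : 'End(Y)) (T2 : 'End(Z))
    (w : W) : W :=
  let: (y, z, x) := w in
  (sigma *: adjoint B1 (B1 y) + T1 y + adjoint B1 x,
   T2 z,
   B1 y + sigma^-1 *: x).

Definition T_op (f1 : Y -> \bar R) (f2 : Z -> \bar R)
    (B1 : 'Hom(Y, X)) (B2 : 'Hom(Z, X)) (c : X) (w : W) : set W :=
  let: (y, z, x) := w in
  [set (phi + adjoint B1 x, psi + adjoint B2 x, c - B1 y - B2 z)
   | phi in subdiff f1 y & psi in subdiff f2 z].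

Definition aug_lagrangian (f1 : Y -> \bar R) (f2 : Z -> \bar R)
    (B1 : 'Hom(Y, X)) (B2 : 'Hom(Z, X)) (c : X) (sigma : R)
    (y : Y) (z : Z) (x : X) : \bar R :=
  (f1 y + f2 z + ('[x, B1 y + B2 z - c]
                  + sigma / 2 * enorm (B1 y + B2 z - c) ^+ 2)%:E)%E.

(* In the minimization over z the summand f1 (y^k) does not depend on z and is
   dropped: y^k (initial or over-relaxed) may lie outside the domain of f1, and
   the objective would then be identically +oo.  In the minimization over y the
   summand f2 (zb^k) is always finite, so it can be kept. *)
Definition pADMM (f1 : Y -> \bar R) (f2 : Z -> \bar R)
    (B1 : 'Hom(Y, X)) (B2 : 'Hom(Z, X)) (c : X) (sigma : R)
    (T1 : 'End(Y)) (T2 : 'End(Z)) (rho : nat -> R) (w0 : W)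
    (w wb : nat -> W) :=
  w 0%N = w0 /\
  forall k,
    let: (y, z, x) := w k in
    let: (yb, zb, xb) := wb k in
    [/\ argmin (fun z' => aug_lagrangian (cst 0%E) f2 B1 B2 c sigma y z' x
                  + (2^-1 * snorm T2 (z' - z) ^+ 2)%:E)%E = [set zb],
        xb = x + sigma *: (B1 y + B2 zb - c),
        argmin (fun y' => aug_lagrangian f1 f2 B1 B2 c sigma y' zb xb
                  + (2^-1 * snorm T1 (y' - y) ^+ 2)%:E)%E = [set yb] &
        w k.+1 = (1 - rho k) *: w k + rho k *: wb k].

End ADMM.

(* Main.v *)
(** With [M] added to [T], the third row of the inclusion [v \in (M + T) w] no
    longer involves [y]: [x] is affine in [z], and then [z] and [y] solve in turn
    [v' \in (subdiff f + Q) u] with [Q = sigma B^* B + T_i].  Taken at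
    [v = M w^k], these are exactly the optimality conditions of the two pADMM
    subproblems.  Since [Sigma_f + Q] is positive definite, [subdiff f + Q] is
    strongly monotone, so solutions are unique and Lipschitz in [v'].  They exist
    because [subdiff f + Q + id] is onto (a strongly convex lower semicontinuous
    function has a minimizer) with a contractive inverse, to which Banach's
    fixed point theorem applies. *)
From HB Require Import structures.
Require Import Defs.
From mathcomp Require Import all_boot all_order all_algebra.
From mathcomp Require Import all_classical all_reals.
From mathcomp Require Import ring lra.

Import Order.TTheory GRing.Theory Num.Theory.
Local Open Scope classical_set_scope.
Local Open Scope ring_scope.

Set Implicit Arguments.
Unset Strict Implicit.

(** * Inner product and norm inequalities *)

Section EuclideanSpace.
Variables (R : realType) (U : euclideanType R).
Implicit Types (u v w : U) (a : R).

Lemma edotDl u v w : '[u + v, w] = '[u, w] + '[v, w].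
Proof. exact: linearDl. Qed.
Lemma edotDr u v w : '[w, u + v] = '[w, u] + '[w, v].
Proof. exact: linearDr. Qed.
Lemma edotNl u w : '[- u, w] = - '[u, w].
Proof. exact: linearNl. Qed.
Lemma edotNr u w : '[w, - u] = - '[w, u].
Proof. exact: linearNr. Qed.
Lemma edotBl u v w : '[u - v, w] = '[u, w] - '[v, w].
Proof. by rewrite edotDl edotNl. Qed.
Lemma edotZl a u w : '[a *: u, w] = a * '[u, w].
Proof. exact: linearZl_LR. Qed.
Lemma edotZr a u w : '[w, a *: u] = a * '[w, u].
Proof. by rewrite edotC edotZl edotC. Qed.
Lemma edot0l w : '[0 : U, w] = 0.
Proof. exact: linear0l. Qed.

Definition edotE := (edotDl, edotDr, edotNl, edotNr, edotZl, edotZr).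

Lemma enorm_ge0 u : 0 <= enorm u.
Proof. exact: sqrtr_ge0. Qed.

Lemma sqr_enorm u : enorm u ^+ 2 = '[u, u].
Proof. by rewrite sqr_sqrtr ?edot_ge0. Qed.

Lemma sqr_snorm (S : U -> U) v : pos_semidef S -> snorm S v ^+ 2 = '[v, S v].
Proof. by move=> S_ge0; rewrite sqr_sqrtr. Qed.

(** The quadratic form of [S] is nonnegative at every [s *: u + t *: v]. When ['[v, S v]] is
    positive, the choice [s = '[v, S v]], [t = - b] gives the bound; the degenerate case ['[v, S v]
    = 0] forces [b = 0]. *)
Lemma psd_cauchy_schwarz (S : 'End(U)) : self_adjoint S -> pos_semidef S ->
  forall u v, '[u, S v] ^+ 2 <= '[u, S u] * '[v, S v].
Proof.
move=> Sadj S_ge0 u v; set b := '[u, S v].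
have bE : '[v, S u] = b by rewrite -Sadj edotC.
have expand s t :
    0 <= s ^+ 2 * '[u, S u] + 2 * (s * t * b) + t ^+ 2 * '[v, S v].
  have := S_ge0 (s *: u + t *: v).
  rewrite !linearD !linearZ /= !edotE bE -/b.
  by congr (0 <= _); ring.
have := S_ge0 v; rewrite le_eqVlt => /predU1P[v0|v_gt0]; last first.
  have := expand '[v, S v] (- b).
  set c := '[v, S v] in v_gt0 *; set a := '[u, S u].
  have -> : c ^+ 2 * a + 2 * (c * - b * b) + (- b) ^+ 2 * c
    = c * (a * c - b ^+ 2) by ring.
  by rewrite pmulr_rge0 // subr_ge0.
rewrite -v0 mulr0 expr2; have [->|b0] := eqVneq b 0; first by rewrite mulr0.
(* For [b] nonzero this [t] would give the form the value [-1]. *)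
have := expand 1 (- ('[u, S u] + 1) / (2 * b)); rewrite -v0 mulr0 addr0.
have -> : 2 * (1 * (- ('[u, S u] + 1) / (2 * b)) * b) = - ('[u, S u] + 1).
  by field.
lra.
Qed.

Lemma edot_le_enorm u v : '[u, v] <= enorm u * enorm v.
Proof.
have id_adj : self_adjoint (\1%VF : 'End(U)) by move=> x y; rewrite !id_lfunE.
have id_ge0 : pos_semidef (\1%VF : 'End(U)).
  by move=> x; rewrite id_lfunE edot_ge0.
have := psd_cauchy_schwarz id_adj id_ge0 u v.
rewrite !id_lfunE -!sqr_enorm -exprMn => h.
have [uv|uv] := lerP 0 '[u, v].
  by rewrite -(@ler_pXn2r _ 2) // nnegrE // mulr_ge0 ?enorm_ge0.
by rewrite (le_trans (ltW uv)) // mulr_ge0 ?enorm_ge0.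
Qed.

Lemma enormN u : enorm (- u) = enorm u.
Proof. by rewrite /enorm edotNl edotNr opprK. Qed.

Lemma enormB u v : enorm (u - v) = enorm (v - u).
Proof. by rewrite -opprB enormN. Qed.

Lemma enormZ a u : enorm (a *: u) = `|a| * enorm u.
Proof.
by rewrite /enorm edotZl edotZr mulrA -expr2 sqrtrM ?sqr_ge0 ?sqrtr_sqr.
Qed.

Lemma enorm0 : enorm (0 : U) = 0.
Proof. by rewrite /enorm edot0l sqrtr0. Qed.

Lemma enormB_le0 u v : enorm (u - v) <= 0 -> u = v.
Proof.
move=> uv; have uv0 : enorm (u - v) = 0 by apply/eqP; rewrite eq_le uv enorm_ge0.
apply/eqP; rewrite -subr_eq0; apply: contraT.
by move=> /(@neq0_dnorm_gt0 _ _ _ edot); rewrite -sqr_enorm uv0 expr0n ltxx.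
Qed.

Lemma ler_enormD u v : enorm (u + v) <= enorm u + enorm v.
Proof.
rewrite -(@ler_pXn2r _ 2) ?nnegrE ?addr_ge0 ?enorm_ge0 //.
rewrite sqrrD !sqr_enorm !edotE (edotC v u).
have := edot_le_enorm u v; lra.
Qed.

Lemma ler_enorm_sum (I : Type) (r : seq I) (F : I -> U) :
  enorm (\sum_(i <- r) F i) <= \sum_(i <- r) enorm (F i).
Proof.
elim/big_rec2: _ => [|i x y _ h]; first by rewrite enorm0.
by rewrite (le_trans (ler_enormD _ _)) // lerD2l.
Qed.

Lemma ler_enormB_trans v u w : enorm (u - w) <= enorm (u - v) + enorm (v - w).
Proof. by rewrite (le_trans _ (ler_enormD _ _)) // addrA subrK. Qed.

End EuclideanSpace.

(** * Coordinates, boundedness of linear maps, coercivity *)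

Section Coordinates.
Variables (R : realType) (U : euclideanType R).
Implicit Types (u v : U).

Local Notation e_ i := ((vbasis {:U})`_i).
Local Notation coord_ i := (coord (vbasis {:U}) i).

Lemma coord_sum u : u = \sum_i coord_ i u *: e_ i.
Proof. by rewrite -coord_vbasis ?memvf. Qed.

(** Each coordinate is the inner product with a Riesz vector, whose norm bounds it by
    Cauchy-Schwarz; the sum of these constants serves all indices at once. *)
Lemma coord_bounded :
  exists2 C : R, 0 <= C & forall i u, `|coord_ i u| <= C * enorm u.
Proof.
have bnd i : exists C : R, forall u, `|coord_ i u| <= C * enorm u.
  have [a aE] := riesz (linfun (coord_ i : U -> R^o)).
  exists (enorm a) => u; have := aE u; rewrite lfunE /= => ->.
  rewrite mulrC ler_norml edot_le_enorm andbT lerNl -edotNl.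
  by rewrite -(enormN u) edot_le_enorm.
have [C CP] := choice bnd.
exists (\sum_i `|C i|) => [|i u]; first exact: sumr_ge0.
rewrite (le_trans (CP i u)) // ler_wpM2r ?enorm_ge0 //.
by rewrite (le_trans (ler_norm _)) // (bigD1 i) //= lerDl sumr_ge0.
Qed.

Lemma linear_bounded (V : euclideanType R) (S : U -> V) : linear S ->
  exists2 C : R, 0 <= C & forall u, enorm (S u) <= C * enorm u.
Proof.
move=> Slin; pose SL := GRing.isLinear.Build R U V _ S Slin.
pose S' : {linear U -> V} := HB.pack S SL.
have [C C0 CP] := coord_bounded.
exists (C * \sum_(i < \dim {:U}) enorm (S (e_ i))) => [|u].
  by rewrite mulr_ge0 // sumr_ge0 // => i _; exact: enorm_ge0.
have -> : S u = \sum_i coord_ i u *: S (e_ i).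
  rewrite {1}(coord_sum u) -[S]/(S' : U -> V) linear_sum.
  by apply: eq_bigr => i _; rewrite linearZ.
rewrite (le_trans (ler_enorm_sum _ _)) // mulrAC mulr_sumr ler_sum // => i _.
by rewrite enormZ ler_wpM2r ?enorm_ge0.
Qed.

(** No compactness is involved: [P] is injective, hence invertible, and Cauchy-Schwarz for the form
    of [P] at [u] and [P^-1 u] gives ['[u, u] ^+ 2 <= '[u, P u] * '[P^-1 u, u]]. With [C] a bound
    for [P^-1], the last factor is at most [C * enorm u ^+ 2]; using [C + 1] keeps the inverse
    positive. *)
Lemma pos_def_coercive (P : 'End(U)) : pos_def P ->
  exists2 a : R, 0 < a & forall u, a * enorm u ^+ 2 <= '[u, P u].
Proof.
move=> [Padj Ppos].
have P_ge0 : pos_semidef P.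
  move=> u; have [->|/Ppos/ltW//] := eqVneq u 0; by rewrite edot0l.
have Pinj : lker P == 0%VS.
  rewrite -subv0; apply/subvP => u; rewrite memv_ker memv0 => /eqP Pu.
  by apply: contraT => /Ppos; rewrite Pu linear0r ltxx.
have [C C0 CP] := linear_bounded (linearP (P^-1)%VF).
exists (C + 1)^-1 => [|u]; first by rewrite invr_gt0 ltr_wpDl.
have PK : P ((P^-1)%VF u) = u by rewrite lker0_lfunVK.
have := psd_cauchy_schwarz Padj P_ge0 u ((P^-1)%VF u).
rewrite PK -sqr_enorm => CS.
have [u0|u0] := eqVneq (enorm u) 0; first by rewrite u0 expr0n mulr0 P_ge0.
have u_gt0 : 0 < enorm u by rewrite lt_neqAle eq_sym u0 enorm_ge0.
rewrite mulrC ler_pdivrMr ?ltr_wpDl //.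
rewrite -(ler_pM2r (exprn_gt0 2 u_gt0)) -expr2 (le_trans CS) //.
rewrite -mulrA ler_wpM2l ?P_ge0 //.
rewrite (le_trans (edot_le_enorm _ _)) // expr2 mulrA ler_wpM2r ?enorm_ge0 //.
by rewrite (le_trans (CP _)) // ler_wpM2r ?enorm_ge0 // lerDl.
Qed.

End Coordinates.

(** * Completeness and Banach's fixed point theorem *)

Section Completeness.
Variables (R : realType) (U : euclideanType R).

(** The supremum is the lower limit of [g] along [D e] as [e] tends to 0: [g u - d] belongs to the
    set and [g u + d] bounds it from above. *)
Lemma real_shrinking_limit (T : Type) (D : R -> set T) (g : T -> R) (d e : R) :
  (forall e, 0 < e -> D e !=set0) ->
  (forall e e', e <= e' -> D e `<=` D e') ->
  0 < e -> (forall u v, D e u -> D e v -> g u - g v <= d) ->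
  forall u, D e u ->
    `|g u - sup [set x | exists2 e, 0 < e & forall v, D e v -> x <= g v]| <= d.
Proof.
move=> D0 Dmono e0 De u Du; set A := [set x | _].
have Au : A (g u - d) by exists e => // v Dv; have := De _ _ Du Dv; lra.
have Aub : ubound A (g u + d).
  move=> x [e' e'0 xP].
  have m0 : 0 < Num.min e e' by rewrite lt_min e0.
  have [v Dv] := D0 _ m0.
  have De'v : D e' v by apply: Dmono Dv; rewrite ge_min lexx orbT.
  have Dev : D e v by apply: Dmono Dv; rewrite ge_min lexx.
  have := xP v De'v; have := De _ _ Dev Du; lra.
have supA : has_sup A by split; [exists (g u - d) | exists (g u + d)].
rewrite ler_norml; apply/andP; split.
  have := ge_sup supA.1 Aub; lra.
have := ub_le_sup supA.2 Au; lra.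
Qed.

(** Cantor's intersection principle, proved coordinatewise. It replaces Cauchy sequences, so that
    approximate fixed points and near-minimizers are handled as sets, without extracting a
    sequence. *)
Lemma shrinking_limit (D : R -> set U) :
  (forall e, 0 < e -> D e !=set0) ->
  (forall e e', e <= e' -> D e `<=` D e') ->
  (forall d, 0 < d -> exists2 e, 0 < e &
     forall u v, D e u -> D e v -> enorm (u - v) <= d) ->
  exists l, forall d, 0 < d -> exists2 e, 0 < e &
    forall u, D e u -> enorm (u - l) <= d.
Proof.
move=> D0 Dmono Dshrink.
have [C C0 CP] := coord_bounded U.
pose lim i : R := sup [set x | exists2 e, 0 < e &
  forall v, D e v -> x <= coord (vbasis {:U}) i v].
pose S := \sum_(i < \dim {:U}) enorm (vbasis {:U})`_i.
have S0 : 0 <= S by apply: sumr_ge0 => i _; exact: enorm_ge0.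
exists (\sum_i lim i *: (vbasis {:U})`_i) => d d0.
have CS0 : 0 < C * S + 1 by rewrite ltr_wpDl // mulr_ge0.
(* At this accuracy every coordinate is within [C * (d / (C * S + 1))] of its limit, and weighting
   by the norms of the basis vectors adds up to at most [d]. *)
have [e e0 De] := Dshrink (d / (C * S + 1)) ltac:(by rewrite divr_gt0).
exists e => // u Du; rewrite {1}(coord_sum u) -sumrB.
rewrite (le_trans (ler_enorm_sum _ _)) //.
apply: (@le_trans _ _ (\sum_(i < \dim {:U})
    C * (d / (C * S + 1)) * enorm (vbasis {:U})`_i)).
  apply: ler_sum => i _; rewrite -scalerBl enormZ ler_wpM2r ?enorm_ge0 //.
  apply: real_shrinking_limit D0 Dmono e0 _ _ Du => v w Dv Dw.
  rewrite -linearB (le_trans (ler_norm _)) // (le_trans (CP _ _)) //.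
  by rewrite ler_wpM2l // De.
rewrite -mulr_sumr -/S.
have -> : C * (d / (C * S + 1)) * S = d * ((C * S) / (C * S + 1)) by ring.
apply: ler_piMr; first exact: ltW.
by rewrite ler_pdivrMr // mul1r lerDl.
Qed.

End Completeness.

(** The sets [D e] of [e]-approximate fixed points shrink to a point, which is fixed. They are
    nonempty because replacing [u] by [T u] multiplies the displacement by at most [k], so its
    infimum is 0. *)
Lemma contraction_fixpoint (R : realType) (U : euclideanType R) (T : U -> U)
    (k : R) : 0 <= k < 1 ->
    (forall u v, enorm (T u - T v) <= k * enorm (u - v)) ->
  exists u, T u = u.
Proof.
move=> /andP[k0 k1] Tk.
pose D (e : R) : set U := [set u | enorm (u - T u) <= e].
have D0 e : 0 < e -> D e !=set0.
  move=> e0; set A := range (fun u => enorm (u - T u)).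
  have Alb : lbound A 0 by move=> _ [u _ <-]; exact: enorm_ge0.
  have infA : has_inf A by split; [exists (enorm (0 - T 0)), 0 | exists 0].
  have m0 : 0 <= inf A by apply: lb_le_inf => //; exact: infA.1.
  have [m_eq0|m_neq0] := eqVneq (inf A) 0.
    have [_ [u _ <-]] := inf_adherent e0 infA.
    by rewrite m_eq0 add0r => /ltW ue; exists u.
  have m_gt0 : 0 < inf A by rewrite lt_neqAle eq_sym m_neq0.
  (* A positive infimum [m] is absurd: a point of displacement below [m + (1 - k) * m] is sent to
     one of displacement below [(1 - (1 - k) ^+ 2) * m], or equal to 0 if [k = 0]. *)
  have k1m : 0 < (1 - k) * inf A by rewrite mulr_gt0 // subr_gt0.
  have [_ [u _ <-] ulem] := inf_adherent k1m infA.
  have : inf A <= enorm (T u - T (T u)).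
    by apply: ge_inf; [exact: infA.2 | exists (T u)].
  have := Tk u (T u); have := ler_wpM2l k0 (ltW ulem).
  have : 0 < (1 - k) * ((1 - k) * inf A) by rewrite mulr_gt0 // subr_gt0.
  nra.
have [||l lP] := @shrinking_limit _ _ D D0.
- by move=> e e' ee' u /le_trans; apply.
(* For [e]-approximate fixed points, [enorm (u - v) <= 2 * e + k * enorm (u - v)]. *)
- move=> d d0; exists ((1 - k) * d / 2) => [|u v].
    by rewrite divr_gt0 // mulr_gt0 // subr_gt0.
  rewrite /D /= => Du Dv; rewrite -subr_gt0 in k1.
  rewrite -(ler_pM2l k1); have := Tk u v.
  have := ler_enormB_trans (T u) u v.
  have := ler_enormB_trans (T v) (T u) v.
  rewrite (enormB (T v) v); lra.
(* The displacement of [l] is split through [u] and [T u] into three terms of size at most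
   [e / 3]. *)
exists l; apply: enormB_le0; apply/ler_addgt0Pr => e e0; rewrite add0r.
have [e' e'0 De'] := lP (e / 3) ltac:(by rewrite divr_gt0).
have m0 : 0 < Num.min e' (e / 3) by rewrite lt_min e'0 divr_gt0.
have [u Du] := D0 _ m0.
have ul : enorm (u - l) <= e / 3.
  by apply: De'; rewrite /D /= (le_trans Du) // ge_min lexx.
have uT : enorm (u - T u) <= e / 3.
  by rewrite (le_trans Du) // ge_min lexx orbT.
have := Tk u l.
have : k * enorm (u - l) <= enorm (u - l) by rewrite ler_piMl ?enorm_ge0 // ltW.
have := ler_enormB_trans u (T l) l; have := ler_enormB_trans (T u) (T l) u.
rewrite (enormB (T l) (T u)) (enormB (T u) u); lra.
Qed.

(** * Optimality conditions and existence of minimizers *)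

Section ConvexAnalysis.
Variables (R : realType) (U : euclideanType R) (f : U -> \bar R).

Lemma proper_fineK u : proper_fun f -> edom f u -> (fine (f u))%:E = f u.
Proof. by move=> [fNy _] fu; rewrite fineK // fin_numE fNy /= lt_eqF. Qed.

Lemma subdiff_edom u phi : proper_fun f -> subdiff f u phi -> edom f u.
Proof.
move=> [fNy [u0 fu0]] /(_ u0) h; rewrite /edom /=.
have {h} := le_lt_trans h fu0.
by have := fNy u; case: (f u) => // r _ _; exact: ltry.
Qed.

Lemma convex_fine u v (t : R) : proper_fun f -> convex_fun f -> 0 <= t <= 1 ->
  edom f u -> edom f v -> let w := t *: u + (1 - t) *: v in
  edom f w /\ fine (f w) <= t * fine (f u) + (1 - t) * fine (f v).
Proof.
move=> fprop fconv t01 fu fv w.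
have := fconv u v t t01; rewrite -/w.
rewrite -(proper_fineK fprop fu) -(proper_fineK fprop fv) -!EFinM -EFinD => h.
have fw : edom f w by rewrite /edom /= (le_lt_trans h) // ltry.
by split => //; move: h; rewrite -{1}(proper_fineK fprop fw) lee_fin.
Qed.

(** A minimizer is compared with points at parameter [t] on the segment towards [v]: after division
    by [t] the quadratic term is of order [t] and vanishes in the limit. Conversely, the subgradient
    inequality gives minimality because the quadratic term is nonnegative. *)
Lemma argmin_subdiff (q : U -> R) (Q : 'End(U)) (g u : U) :
    proper_fun f -> convex_fun f -> pos_semidef Q ->
    (forall v, q v = q u + '[g, v - u] + 2^-1 * '[v - u, Q (v - u)]) ->
  argmin (fun v => f v + (q v)%:E)%E u <-> subdiff f u (- g).
Proof.
move=> fprop fconv Q_ge0 qE; split=> [umin|gsub].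
  have fu : edom f u.
    have [u0 fu0] := fprop.2; have := umin u0.
    rewrite -(proper_fineK fprop fu0) -EFinD /edom /=.
    have := fprop.1 u; case: (f u) => [r _ _|_|//]; first exact: ltry.
    by rewrite addye // leye_eq.
  move=> v; have [fv|] := boolP (f v < +oo)%E; last first.
    by rewrite -leNgt leye_eq => /eqP ->; rewrite leey.
  rewrite -(proper_fineK fprop fu) -(proper_fineK fprop fv) -EFinD lee_fin.
  rewrite edotNl; set a := fine (f u); set b := fine (f v).
  set d := v - u; set K := '[d, Q d].
  have K0 : 0 <= K by exact: Q_ge0.
  have step t : 0 < t <= 1 -> 0 <= b - a + '[g, d] + t / 2 * K.
    move=> /andP[t0 t1]; have t01 : 0 <= t <= 1 by rewrite ltW.
    have [fw fwle] := convex_fine fprop fconv t01 fv fu.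
    move: fw fwle; set w := _ + _ => fw; rewrite -/a -/b => fwle.
    have := umin w.
    rewrite -(proper_fineK fprop fu) -(proper_fineK fprop fw) -!EFinD lee_fin.
    have wu : w - u = t *: d.
      by rewrite /w scalerBr scalerBl scale1r addrCA addrAC subrr add0r addrC.
    have Qtd : Q (t *: d) = t *: Q d by rewrite linearZ.
    rewrite (qE w) wu Qtd !edotZl !edotZr -/a -/K => h.
    rewrite -(pmulr_rge0 _ t0); lra.
  case: (lerP 0 (b - a + '[g, d])) => s; first lra.
  set s0 := b - a + '[g, d] in s step *.
  (* In place of a limit in [t]: if [s0] were negative, [t = - s0 / (K + 1 - s0)] would lie between
     0 and 1 and make the bound of [step] negative. *)
  have den : 0 < K + 1 - s0 by lra.
  have := step (- s0 / (K + 1 - s0)).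
  rewrite divr_gt0 ?ler_pdivrMr ?oppr_gt0 //= mul1r.
  have -> : - s0 <= K + 1 - s0 by lra.
  have -> : s0 + - s0 / (K + 1 - s0) / 2 * K
    = s0 * ((K + 2 - 2 * s0) / (2 * (K + 1 - s0))).
    by field; apply: lt0r_neq0.
  move=> /(_ isT); rewrite nmulr_rge0 //.
  rewrite leNgt divr_gt0 ?mulr_gt0 //; lra.
have fu := subdiff_edom fprop gsub.
move=> v; have [fv|] := boolP (f v < +oo)%E; last first.
  by rewrite -leNgt leye_eq => /eqP ->; rewrite addye ?leey.
have := gsub v.
rewrite -(proper_fineK fprop fu) -(proper_fineK fprop fv) -!EFinD !lee_fin.
rewrite edotNl (qE v); have := Q_ge0 (v - u); lra.
Qed.

Lemma argminDr (k : R) : argmin (fun v => f v + k%:E)%E = argmin f.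
Proof. by apply/seteqP; split=> u umin v; have := umin v; rewrite leeD2rE. Qed.

(* [f] is bounded below near [u0] by lower semicontinuity, and convexity along
   the segments issued from [u0] spreads the bound to the whole space. *)
Lemma convex_linear_minorant :
  proper_fun f -> closed_fun f -> convex_fun f ->
  exists u0 (a K : R), forall v, edom f v ->
    a - K * enorm (v - u0) <= fine (f v).
Proof.
move=> fprop fclos fconv; have [u0 fu0] := fprop.2.
set a := fine (f u0).
have [|e e0 eP] := fclos u0 (a - 1).
  by rewrite -(proper_fineK fprop fu0) lte_fin -/a; lra.
exists u0, (a - 1), (2 / e) => v fv; set n := enorm (v - u0).
have n0 : 0 <= n by exact: enorm_ge0.
have en : 0 <= 2 / e * n by rewrite mulr_ge0 // divr_ge0 // ltW.
have [ne|en'] := ltP n e.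
  have := eP _ ne; rewrite -(proper_fineK fprop fv) lte_fin; lra.
have n_gt0 : 0 < n by lra.
(* The point [w] at this parameter lies at distance [e / 2] from [u0], so [a - 1] is a lower bound
   there. Convexity then yields [fine (f v) > a - 1 / t], and [1 / t = 2 / e * n] accounts for the
   slope [2 / e]. *)
have t0 : 0 < e / (2 * n) by rewrite divr_gt0 // mulr_gt0.
have t1 : e / (2 * n) <= 1 by rewrite ler_pdivrMr ?mulr_gt0 //; lra.
set t := e / _ in t0 t1.
have t01 : 0 <= t <= 1 by rewrite ltW.
have [fw fwle] := convex_fine fprop fconv t01 fv fu0.
move: fw fwle; set w := _ + _ => fw; rewrite -/a => fwle.
have wu : w - u0 = t *: (v - u0).
  by rewrite /w scalerBr scalerBl scale1r addrCA addrAC subrr add0r addrC.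
have := eP w; rewrite wu enormZ gtr0_norm // -/n.
have -> : t * n = e / 2 by rewrite /t; field; rewrite lt0r_neq0.
move=> /(_ ltac:(lra)); rewrite -(proper_fineK fprop fw) lte_fin => aw.
have tn : t * (2 / e * n) = 1 by rewrite /t; field; rewrite !lt0r_neq0.
rewrite -(ler_pM2l t0) mulrBr tn; nra.
Qed.

(* The near-minimizers of the strongly convex [f u + 2^-1 * '[u, P u] - '[v, u]]
   have vanishing diameter by the parallelogram identity. *)
Lemma prox_exists (P : 'End(U)) (v : U) :
    proper_fun f -> closed_fun f -> convex_fun f ->
    self_adjoint P -> (forall d, '[d, d] <= '[d, P d]) ->
  exists u, subdiff f u (v - P u).
Proof.
move=> fprop fclos fconv Padj P1.
have P_ge0 : pos_semidef P by move=> d; rewrite (le_trans _ (P1 d)) ?edot_ge0.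
pose p u : R := 2^-1 * '[u, P u] - '[v, u].
have pE u w : p w = p u + '[P u - v, w - u] + 2^-1 * '[w - u, P (w - u)].
  rewrite /p !linearB /= !edotE !Padj.
  by rewrite (_ : '[u, P w] = '[w, P u]) -?Padj 1?edotC //; lra.
pose A := [set fine (f u) + p u | u in edom f].
have Alb : has_lbound A.
  have [u0 [a [K aP]]] := convex_linear_minorant fprop fclos fconv.
  (* The objective is at least [a + p u0 - (K + G) * n + n ^+ 2 / 2]; completing the square in [n]
     gives this bound. *)
  exists (a + p u0 - (K + enorm (P u0 - v)) ^+ 2 / 2) => _ [u fu <-].
  have := aP _ fu; rewrite (pE u0 u).
  have := P1 (u - u0); rewrite -sqr_enorm.
  have := edot_le_enorm (- (P u0 - v)) (u - u0); rewrite edotNl enormN.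
  set n := enorm (u - u0); set G := enorm (P u0 - v).
  have := sqr_ge0 (n - (K + G)); nra.
have infA : has_inf A.
  by split=> //; have [u fu] := fprop.2; exists (fine (f u) + p u), u.
have m_le u : edom f u -> inf A <= fine (f u) + p u.
  by move=> fu; apply: ge_inf => //; exists u.
pose D (e : R) := [set u | edom f u /\ fine (f u) + p u <= inf A + e].
have D0 e : 0 < e -> D e !=set0.
  by move=> e0; have [_ [u fu <-] /ltW] := inf_adherent e0 infA; exists u.
have [||l lP] := @shrinking_limit _ _ D D0.
- by move=> e e' ee' u [fu ue]; split => //; rewrite (le_trans ue) // lerD2l.
(* At the midpoint [x] the objective is at least [inf A], while the quadratic gains
   [enorm (u - w) ^+ 2 / 4] over the two endpoints; hence [enorm (u - w) ^+ 2 <= 8 * e]. *)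
- move=> d d0; exists (d ^+ 2 / 8) => [|u w [fu ue] [fw we]].
    by rewrite divr_gt0 // exprn_gt0.
  have h01 : 0 <= 2^-1 :> R /\ 2^-1 <= 1 :> R by lra.
  move/andP: h01 => h01.
  have [fx fxle] := convex_fine fprop fconv h01 fu fw.
  move: fx fxle; set x := _ + _ => fx fxle.
  have halves : 2^-1 + 2^-1 = 1 :> R by lra.
  have half : 1 - 2^-1 = 2^-1 :> R by lra.
  have ux : u - x = 2^-1 *: (u - w).
    apply/eqP; rewrite subr_eq addrC /x half scalerBr addrACA subrr addr0.
    by rewrite -scalerDl halves scale1r.
  have wx : w - x = - (2^-1 *: (u - w)).
    apply/eqP; rewrite subr_eq addrC /x half scalerBr opprB addrC addrA subrK.
    by rewrite -scalerDl halves scale1r.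
  have Pd : P (2^-1 *: (u - w)) = 2^-1 *: P (u - w) by rewrite linearZ.
  have PNd : P (- (2^-1 *: (u - w))) = - (2^-1 *: P (u - w)).
    by rewrite -Pd linearN.
  have pu := pE x u; rewrite ux Pd in pu.
  have pw := pE x w; rewrite wx PNd in pw.
  rewrite !(edotNl, edotNr, edotZl, edotZr) in pu pw.
  have mx := m_le _ fx; have := P1 (u - w); rewrite -sqr_enorm => duw.
  suff : enorm (u - w) ^+ 2 <= d ^+ 2.
    by rewrite ler_pXn2r // nnegrE ?enorm_ge0 // ltW.
  lra.
have fl : (f l <= (inf A - p l)%:E)%E.
  (* As [f l] is not yet known to be finite, lower semicontinuity is applied to every real [a]
     strictly below it. *)
  have key a : (a%:E < f l)%E -> a <= inf A - p l.
    move=> /fclos[e e0 eP]; apply/ler_addgt0Pr => d d0.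
    set G := enorm (P l - v); have G0 : 0 <= G by exact: enorm_ge0.
    (* The error [d] is shared: [d / (1 + G)] for near-minimality of [u], and [G * (d / (1 + G))]
       for the linear term of [p] at [l]. *)
    have dG : 0 < d / (1 + G) by rewrite divr_gt0 // ltr_wpDr.
    have r0 : 0 < Num.min (e / 2) (d / (1 + G)) by rewrite lt_min dG divr_gt0.
    have [e' e'0 De'] := lP _ r0.
    have r'0 : 0 < Num.min e' (d / (1 + G)) by rewrite lt_min e'0.
    have [u [fu ule]] := D0 _ r'0.
    have ul : enorm (u - l) <= Num.min (e / 2) (d / (1 + G)).
      by apply: De'; split => //; rewrite (le_trans ule) // lerD2l ge_min lexx.
    have := ul; rewrite le_min => /andP[ule2 uld].
    have := eP u ltac:(lra); rewrite -(proper_fineK fprop fu) lte_fin => au.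
    have mle : Num.min e' (d / (1 + G)) <= d / (1 + G).
      by rewrite ge_min lexx orbT.
    have := pE l u; have := P_ge0 (u - l).
    have := edot_le_enorm (- (P l - v)) (u - l); rewrite edotNl enormN -/G.
    have : G * enorm (u - l) <= G * (d / (1 + G)) by rewrite ler_wpM2l.
    have : d = d / (1 + G) + G * (d / (1 + G)).
      by field; rewrite lt0r_neq0 // ltr_wpDr.
    lra.
  rewrite leNgt; apply/negP; case: (f l) key (fprop.1 l) => [r|//|//] key _ h.
    have := key ((r + (inf A - p l)) / 2); rewrite !lte_fin in h *; lra.
  have := key (inf A - p l + 1) (ltry _); lra.
exists l; rewrite -opprB; apply/(argmin_subdiff fprop fconv P_ge0 (pE l)) => u.
have [fu|] := boolP (f u < +oo)%E; last first.
  by rewrite -leNgt leye_eq => /eqP ->; rewrite addye ?leey.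
have fl' : edom f l by rewrite /edom /= (le_lt_trans fl) // ltry.
move: fl; rewrite -(proper_fineK fprop fl') -(proper_fineK fprop fu) -!EFinD.
rewrite !lee_fin; have := m_le _ fu; lra.
Qed.

End ConvexAnalysis.

(** * Strongly monotone inclusions: stability, uniqueness, existence *)

Section StronglyMonotoneInclusion.
Variables (R : realType) (U : euclideanType R) (f : U -> \bar R).
Variables (Sigma : 'End(U)).
Hypotheses (fprop : proper_fun f) (SigmaP : convexity_operator f Sigma).

(** Monotonicity of the subdifferential with modulus [Sigma] bounds the coercive form at
    [d = u1 - u2] by ['[v1 - v2, d]]; Cauchy-Schwarz and division by [enorm d] finish. *)
Lemma subdiff_shift_monotone (Q : 'End(U)) (a : R) (u1 u2 v1 v2 : U) :
    (forall u, a * enorm u ^+ 2 <= '[u, Sigma u] + '[u, Q u]) ->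
    subdiff f u1 (v1 - Q u1) -> subdiff f u2 (v2 - Q u2) ->
  a * enorm (u1 - u2) <= enorm (v1 - v2).
Proof.
move=> aP s1 s2; have [_ Sigma_ge0 SigmaM] := SigmaP.
have [_] := SigmaM _ _ _ _ (subdiff_edom fprop s1) (subdiff_edom fprop s2) s1 s2.
rewrite sqr_snorm //; set d := u1 - u2.
have -> : v1 - Q u1 - (v2 - Q u2) = (v1 - v2) - Q d.
  by rewrite /d (linearB Q) !opprB [Q u2 - v2]addrC addrACA [- Q u1 + _]addrC.
rewrite edotBl [ '[Q d, d] ]edotC => mono.
have [d0|d0] := eqVneq (enorm d) 0; first by rewrite d0 mulr0 enorm_ge0.
have d_gt0 : 0 < enorm d by rewrite lt_neqAle eq_sym d0 enorm_ge0.
rewrite -(ler_pM2r d_gt0).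
have := aP d; have := edot_le_enorm (v1 - v2) d; lra.
Qed.

Lemma subdiff_shift_unique (Q : 'End(U)) (a : R) (u1 u2 v : U) : 0 < a ->
    (forall u, a * enorm u ^+ 2 <= '[u, Sigma u] + '[u, Q u]) ->
    subdiff f u1 (v - Q u1) -> subdiff f u2 (v - Q u2) ->
  u1 = u2.
Proof.
move=> a0 aP s1 s2; have := subdiff_shift_monotone aP s1 s2.
rewrite subrr enorm0 pmulr_rle0 // => h.
by apply: enormB_le0; rewrite h.
Qed.

(* With [J] the inverse of [id + subdiff f + Q], the solutions are the fixed
   points of [w |-> J (v + w)]. *)
Lemma subdiff_shift_surjective (Q : 'End(U)) (a : R) (v : U) :
    closed_fun f -> convex_fun f -> self_adjoint Q -> pos_semidef Q -> 0 < a ->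
    (forall u, a * enorm u ^+ 2 <= '[u, Sigma u] + '[u, Q u]) ->
  exists u, subdiff f u (v - Q u).
Proof.
move=> fclos fconv Qadj Q_ge0 a0 aP.
pose P := (Q + \1)%VF.
have PE u : P u = Q u + u by rewrite add_lfunE id_lfunE.
have Padj : self_adjoint P.
  by move=> x y; rewrite !PE edotDl edotDr Qadj.
have P1 d : '[d, d] <= '[d, P d] by rewrite PE edotDr lerDr Q_ge0.
have [J JP] := choice (fun w => prox_exists (v + w) fprop fclos fconv Padj P1).
have a1 : 0 < 1 + a by rewrite addr_gt0.
(* Adding the identity raises the modulus from [a] to [1 + a], which makes [J] a contraction of
   factor [(1 + a)^-1]. *)
have aP1 u : (1 + a) * enorm u ^+ 2 <= '[u, Sigma u] + '[u, P u].
  by rewrite PE edotDr -sqr_enorm; have := aP u; lra.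
have [||u uJ] := @contraction_fixpoint _ _ J (1 + a)^-1.
- by rewrite invr_ge0 ltW //= invf_lt1 // ltrDl.
- move=> w1 w2; have := subdiff_shift_monotone aP1 (JP w1) (JP w2).
  rewrite opprD addrACA subrr add0r => h.
  by rewrite mulrC ler_pdivlMr // mulrC.
exists u; have := JP u; rewrite uJ PE.
by rewrite opprD addrACA subrr addr0.
Qed.

(** Bridges the assumption, where the Gram operator has weight 1, and the subproblems, where it has
    weight [sigma]: scaling by [Num.min 1 s] lowers each of the three forms enough. *)
Lemma pos_def_scale_coercive (S B Q : 'End(U)) (s : R) :
    0 < s -> pos_semidef S -> pos_semidef B -> pos_semidef Q ->
    pos_def (S + B + Q)%VF ->
  exists2 a : R, 0 < a &
    forall u, a * enorm u ^+ 2 <= '[u, S u] + '[u, (s *: B + Q)%VF u].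
Proof.
move=> s0 S0 B0 Q0 /pos_def_coercive[a a0 aP].
have m0 : 0 < Num.min 1 s by rewrite lt_min ltr01.
exists (Num.min 1 s * a) => [|u]; first by rewrite mulr_gt0.
rewrite -mulrA (le_trans (ler_wpM2l (ltW m0) (aP u))) //.
rewrite !add_lfunE scale_lfunE !edotE !mulrDr.
have m1 : Num.min 1 s <= 1 by rewrite ge_min lexx.
have ms : Num.min 1 s <= s by rewrite ge_min lexx orbT.
have := ler_wpM2r (S0 u) m1; have := ler_wpM2r (Q0 u) m1.
have := ler_wpM2r (B0 u) ms; lra.
Qed.

End StronglyMonotoneInclusion.

(** * The norm of a product space *)

Section ProductNorm.
Variables (R : realType) (U V : euclideanType R).

Lemma prod_edotE (p q : U * V) : '[p, q] = '[p.1, q.1] + '[p.2, q.2].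
Proof. by []. Qed.

Lemma enorm_fst (p : U * V) : enorm p.1 <= enorm p.
Proof. by rewrite ler_wsqrtr // prod_edotE lerDl edot_ge0. Qed.

Lemma enorm_snd (p : U * V) : enorm p.2 <= enorm p.
Proof. by rewrite ler_wsqrtr // prod_edotE lerDr edot_ge0. Qed.

Lemma ler_enorm_prod (p : U * V) : enorm p <= enorm p.1 + enorm p.2.
Proof.
rewrite -(@ler_pXn2r _ 2) ?nnegrE ?addr_ge0 ?enorm_ge0 //.
rewrite sqrrD !sqr_enorm prod_edotE.
by rewrite addrAC lerDl mulrn_wge0 // mulr_ge0 ?enorm_ge0.
Qed.

End ProductNorm.

(** * The quadratic subproblem of one ADMM block *)

Section ADMMStep.
Variables (R : realType) (U X : euclideanType R).
Variables (B : 'Hom(U, X)) (sigma : R) (S : 'End(U)).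
Hypotheses (sigma_gt0 : 0 < sigma) (Sadj : self_adjoint S).
Hypothesis (S_ge0 : pos_semidef S).

Definition penalized : 'End(U) := sigma *: (adjoint B \o B)%VF + S.

Lemma penalizedE u : penalized u = sigma *: adjoint B (B u) + S u.
Proof. by rewrite add_lfunE scale_lfunE comp_lfunE. Qed.

Lemma edot_adjoint (x : X) u : '[adjoint B x, u] = '[x, B u].
Proof. by rewrite edotC -adjointP edotC. Qed.

Lemma gram_ge0 : pos_semidef (adjoint B \o B)%VF.
Proof. by move=> u; rewrite comp_lfunE -adjointP edot_ge0. Qed.

Lemma penalized_adj : self_adjoint penalized.
Proof.
move=> u v; rewrite !penalizedE !edotDl !edotDr edotZl edotZr Sadj.
by rewrite edot_adjoint -adjointP.
Qed.

Lemma penalized_ge0 : pos_semidef penalized.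
Proof.
move=> u; rewrite penalizedE edotDr edotZr -adjointP.
by rewrite addr_ge0 ?S_ge0 // mulr_ge0 ?edot_ge0 // ltW.
Qed.

(** The part common to both subproblems besides the nonsmooth function; [r] gathers the terms of the
    constraint residual that stay fixed during the minimization. *)
Definition prox_quadratic (x r : X) (u0 v : U) : R :=
  '[x, B v + r] + sigma / 2 * enorm (B v + r) ^+ 2
  + 2^-1 * snorm S (v - u0) ^+ 2.

(** The exact second-order Taylor expansion at [u], with Hessian [penalized], in the shape required
    by [argmin_subdiff]. *)
Lemma prox_quadraticE x r u0 u v :
  prox_quadratic x r u0 v = prox_quadratic x r u0 u
    + '[adjoint B (x + sigma *: (B u + r)) + S (u - u0), v - u]
    + 2^-1 * '[v - u, penalized (v - u)].
Proof.
rewrite /prox_quadratic !sqr_snorm // !sqr_enorm penalizedE.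
have -> : B v + r = (B u + r) + B (v - u).
  by rewrite addrAC -linearD (addrC u) subrK.
have -> : v - u0 = (u - u0) + (v - u) by rewrite [RHS]addrC addrA subrK.
move: (v - u) (u - u0) (B u + r) => d e a.
rewrite (linearD S) !edotE edot_adjoint -adjointP !edotE.
rewrite (edotC (B d) a) (Sadj e d) -(Sadj d e) (edotC (S d) e).
lra.
Qed.

Lemma argmin_prox (f : U -> \bar R) x r u0 u :
    proper_fun f -> convex_fun f ->
  argmin (fun v => f v + (prox_quadratic x r u0 v)%:E)%E u <->
  subdiff f u (S u0 - adjoint B (x + sigma *: r) - penalized u).
Proof.
move=> fprop fconv; have qE := prox_quadraticE x r u0 u.
have -> : S u0 - adjoint B (x + sigma *: r) - penalized u =
    - (adjoint B (x + sigma *: (B u + r)) + S (u - u0)).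
  (* Pairing with an arbitrary [w] turns the vector identity into a scalar one within reach of
     [lra]; later vector identities are checked in the same way. *)
  rewrite penalizedE; apply: edot_inj => w.
  by rewrite (linearB S) !edotE -!adjointP !edotE; lra.
exact: argmin_subdiff fprop fconv penalized_ge0 qE.
Qed.

End ADMMStep.

(** * Linearity, symmetry and positivity of the preconditioner *)

Section DegeneratePreconditioner.
Variables (R : realType) (Y Z X : euclideanType R).
Variables (B1 : 'Hom(Y, X)) (T1 : 'End(Y)) (T2 : 'End(Z)) (sigma : R).
Hypothesis sigma_gt0 : 0 < sigma.
Local Notation M := (M_op sigma B1 T1 T2).

Lemma M_op_linear : linear M.
Proof.
move=> a [[y z] x] [[y' z'] x'] /=; congr (_, _, _).
- rewrite !linearP /=; apply: edot_inj => w; rewrite !edotE; lra.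
- exact: linearP.
- rewrite linearP /=; apply: edot_inj => w; rewrite !edotE; lra.
Qed.

Lemma M_op_bounded : bounded_op M.
Proof. by have [C _ CP] := linear_bounded M_op_linear; exists C. Qed.

Lemma M_op_self_adjoint :
  self_adjoint T1 -> self_adjoint T2 -> self_adjoint M.
Proof.
move=> T1adj T2adj [[y z] x] [[y' z'] x'] /=.
rewrite !prod_edotE /= !edotE !edot_adjoint -!adjointP T1adj T2adj.
rewrite (edotC x (B1 y')); lra.
Qed.

(** Completing the square, the form of [M] is [sigma] times the squared norm of
    [B1 y + sigma^-1 *: x], plus the forms of [T1] and [T2]. *)
Lemma M_op_ge0 : pos_semidef T1 -> pos_semidef T2 -> pos_semidef M.
Proof.
move=> T1_ge0 T2_ge0 [[y z] x] /=.
rewrite !prod_edotE /= !edotE -!adjointP.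
have := T1_ge0 y; have := T2_ge0 z.
have := mulr_ge0 (ltW sigma_gt0) (edot_ge0 (B1 y + sigma^-1 *: x)).
rewrite !edotE (edotC x (B1 y)).
have sV : sigma * sigma^-1 = 1 by rewrite divff // gt_eqF.
have -> : sigma * ('[B1 y, B1 y] + sigma^-1 * '[B1 y, x]
    + (sigma^-1 * '[B1 y, x] + sigma^-1 * (sigma^-1 * '[x, x])))
  = sigma * '[B1 y, B1 y] + '[B1 y, x] + '[B1 y, x] + sigma^-1 * '[x, x].
  by field; rewrite gt_eqF.
lra.
Qed.

End DegeneratePreconditioner.

(** * The resolvent and its identification with an ADMM step *)

Section Resolvent.
Variables (R : realType) (Y Z X : euclideanType R).
Variables (f1 : Y -> \bar R) (f2 : Z -> \bar R).
Variables (B1 : 'Hom(Y, X)) (B2 : 'Hom(Z, X)) (c : X).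
Variables (T1 : 'End(Y)) (T2 : 'End(Z)) (sigma : R).
Hypothesis sigma_gt0 : 0 < sigma.
Local Notation M := (M_op sigma B1 T1 T2).
Local Notation T := (T_op f1 f2 B1 B2 c).
Local Notation Q1 := (penalized B1 sigma T1).
Local Notation Q2 := (penalized B2 sigma T2).

(** [B1 y] cancels between the third rows of [M] and [T], which makes the system triangular in the
    order [z], [x], [y]. The factor 2 arises because [adjoint B1 x] occurs in the first row of both
    operators. *)
Lemma resolventE v1 v2 v3 y z x :
  resolvent M T (v1, v2, v3) (y, z, x) <->
  [/\ x = sigma *: (v3 - c + B2 z),
      subdiff f2 z (v2 - sigma *: adjoint B2 (v3 - c) - Q2 z) &
      subdiff f1 y (v1 - 2 *: adjoint B1 x - Q1 y)].
Proof.
have sV : sigma * sigma^-1 = 1 by rewrite divff // gt_eqF.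
split=> [[_ [phi sphi [psi spsi <-]]] /= [e1 e2 e3]|[-> s2 s1]].
  have xE : x = sigma *: (v3 - c + B2 z).
    apply: edot_inj => w; have := congr1 (edot w) e3; rewrite !edotE => e.
    have : sigma * (sigma^-1 * '[w, x]) = '[w, x] by rewrite mulrA sV mul1r.
    rewrite -e; lra.
  split=> //.
    suff -> : v2 - sigma *: adjoint B2 (v3 - c) - Q2 z = psi by [].
    rewrite penalizedE; apply: edot_inj => w; have := congr1 (edot w) e2.
    by rewrite xE !edotE -!adjointP !edotE; lra.
  suff -> : v1 - 2 *: adjoint B1 x - Q1 y = phi by [].
  rewrite penalizedE; apply: edot_inj => w; have := congr1 (edot w) e1.
  by rewrite !edotE; lra.
set x' := sigma *: _ in s1 *.
exists (v1 - 2 *: adjoint B1 x' - Q1 y + adjoint B1 x',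
        v2 - sigma *: adjoint B2 (v3 - c) - Q2 z + adjoint B2 x',
        c - B1 y - B2 z).
  exists (v1 - 2 *: adjoint B1 x' - Q1 y) => //.
  by exists (v2 - sigma *: adjoint B2 (v3 - c) - Q2 z).
rewrite /= !penalizedE; congr (_, _, _); apply: edot_inj => w.
- by rewrite !edotE; lra.
- by rewrite /x' !edotE -!adjointP !edotE; lra.
- rewrite /x' scalerA mulrC sV scale1r !edotE; lra.
Qed.

Hypotheses (f1prop : proper_fun f1) (f2prop : proper_fun f2).
Hypotheses (f1clos : closed_fun f1) (f2clos : closed_fun f2).
Hypotheses (f1conv : convex_fun f1) (f2conv : convex_fun f2).
Hypotheses (T1adj : self_adjoint T1) (T2adj : self_adjoint T2).
Hypotheses (T1_ge0 : pos_semidef T1) (T2_ge0 : pos_semidef T2).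
Variables (Sigma1 : 'End(Y)) (Sigma2 : 'End(Z)).
Hypotheses (Sigma1P : convexity_operator f1 Sigma1).
Hypotheses (Sigma2P : convexity_operator f2 Sigma2).
Hypothesis hpd1 : pos_def (Sigma1 + (adjoint B1 \o B1)%VF + T1).
Hypothesis hpd2 : pos_def (Sigma2 + (adjoint B2 \o B2)%VF + T2).

Let coercive1 : exists2 a : R, 0 < a &
  forall u, a * enorm u ^+ 2 <= '[u, Sigma1 u] + '[u, Q1 u].
Proof.
have [_ S0 _] := Sigma1P.
exact: pos_def_scale_coercive sigma_gt0 S0 (gram_ge0 _) T1_ge0 hpd1.
Qed.

Let coercive2 : exists2 a : R, 0 < a &
  forall u, a * enorm u ^+ 2 <= '[u, Sigma2 u] + '[u, Q2 u].
Proof.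
have [_ S0 _] := Sigma2P.
exact: pos_def_scale_coercive sigma_gt0 S0 (gram_ge0 _) T2_ge0 hpd2.
Qed.

Lemma resolvent_full : full_domain (resolvent M T).
Proof.
move=> [[v1 v2] v3].
have [a1 a1_gt0 a1P] := coercive1; have [a2 a2_gt0 a2P] := coercive2.
have [z zP] := subdiff_shift_surjective f2prop Sigma2P
  (v2 - sigma *: adjoint B2 (v3 - c)) f2clos f2conv (penalized_adj _ _ T2adj)
  (penalized_ge0 _ sigma_gt0 T2_ge0) a2_gt0 a2P.
set x := sigma *: (v3 - c + B2 z).
have [y yP] := subdiff_shift_surjective f1prop Sigma1P
  (v1 - 2 *: adjoint B1 x) f1clos f1conv (penalized_adj _ _ T1adj)
  (penalized_ge0 _ sigma_gt0 T1_ge0) a1_gt0 a1P.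
by exists (y, z, x); apply/resolventE.
Qed.

Lemma resolvent_lipschitz : exists L : R, forall v v' w w',
  resolvent M T v w -> resolvent M T v' w' ->
  enorm (w - w') <= L * enorm (v - v').
Proof.
have [a1 a1_gt0 a1P] := coercive1; have [a2 a2_gt0 a2P] := coercive2.
have [C1 C1_ge0 C1P] := linear_bounded (linearP (adjoint B1)).
have [C2 C2_ge0 C2P] := linear_bounded (linearP B2).
have [C3 C3_ge0 C3P] := linear_bounded (linearP (adjoint B2)).
(* Lipschitz constants of [z], [x] and [y], in the order in which the triangular system is solved;
   each one feeds the next. *)
pose Kz := (1 + sigma * C3) / a2; pose Kx := sigma * (1 + C2 * Kz).
pose Ky := (1 + 2 * C1 * Kx) / a1.
exists (Ky + Kz + Kx) => [[[v1 v2] v3]] [[v1' v2'] v3'] [[y z] x] [[y' z'] x'].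
move=> /resolventE[xE s2 s1] /resolventE[xE' s2' s1'].
set n := enorm ((v1, v2, v3) - _).
have n12 : enorm ((v1, v2) - (v1', v2')) <= n.
  exact: (enorm_fst ((v1, v2, v3) - (v1', v2', v3'))).
have n1 : enorm (v1 - v1') <= n.
  exact: le_trans (enorm_fst ((v1, v2) - (v1', v2'))) n12.
have n2 : enorm (v2 - v2') <= n.
  exact: le_trans (enorm_snd ((v1, v2) - (v1', v2'))) n12.
have n3 : enorm (v3 - v3') <= n.
  exact: (enorm_snd ((v1, v2, v3) - (v1', v2', v3'))).
have zK : enorm (z - z') <= Kz * n.
  rewrite /Kz mulrAC ler_pdivlMr //.
  have := subdiff_shift_monotone f2prop Sigma2P a2P s2 s2'.
  rewrite [X in _ <= enorm X -> _](_ : _ = v2 - v2'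
    - sigma *: adjoint B2 (v3 - v3')); last first.
    by apply: edot_inj => w; rewrite !edotE -!adjointP !edotE; lra.
  have := ler_enormD (v2 - v2') (- (sigma *: adjoint B2 (v3 - v3'))).
  rewrite enormN enormZ gtr0_norm //.
  have := ler_wpM2l (ltW sigma_gt0) (C3P (v3 - v3')).
  have := ler_wpM2l (mulr_ge0 (ltW sigma_gt0) C3_ge0) n3.
  lra.
have xK : enorm (x - x') <= Kx * n.
  rewrite xE xE' -scalerBr enormZ gtr0_norm // /Kx -mulrA ler_pM2l //.
  rewrite [X in enorm X <= _](_ : _ = v3 - v3' + B2 (z - z')); last first.
    by apply: edot_inj => w; rewrite linearB !edotE; lra.
  have := ler_enormD (v3 - v3') (B2 (z - z')).
  have := C2P (z - z'); have := ler_wpM2l C2_ge0 zK; lra.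
have yK : enorm (y - y') <= Ky * n.
  rewrite /Ky mulrAC ler_pdivlMr //.
  have := subdiff_shift_monotone f1prop Sigma1P a1P s1 s1'.
  rewrite [X in _ <= enorm X -> _](_ : _ = v1 - v1'
    - 2 *: adjoint B1 (x - x')); last first.
    by apply: edot_inj => w; rewrite !edotE -!adjointP !edotE; lra.
  have := ler_enormD (v1 - v1') (- (2 *: adjoint B1 (x - x'))).
  rewrite enormN enormZ gtr0_norm //.
  have := C1P (x - x'); have := ler_wpM2l C1_ge0 xK.
  lra.
have := ler_enorm_prod ((y, z, x) - (y', z', x')).
have := ler_enorm_prod ((y, z, x) - (y', z', x')).1.
rewrite /=; lra.
Qed.

Lemma resolvent_single_valued : single_valued (resolvent M T).
Proof.
move=> v w w' vw vw'; have [L LP] := resolvent_lipschitz.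
have := LP _ _ _ _ vw vw'; rewrite subrr enorm0 mulr0 => h.
by apply: enormB_le0; rewrite h.
Qed.

(** The optimality conditions of the two subproblems and the multiplier update are the three
    conditions of [resolventE] at [M (y, z, x)]. Since the minimizers are stated as singletons, the
    converse also relies on uniqueness for the inclusions. *)
Lemma admm_stepE y z x yb zb xb :
  [/\ argmin (fun z' => aug_lagrangian (cst 0%E) f2 B1 B2 c sigma y z' x
              + (2^-1 * snorm T2 (z' - z) ^+ 2)%:E)%E = [set zb],
      xb = x + sigma *: (B1 y + B2 zb - c) &
      argmin (fun y' => aug_lagrangian f1 f2 B1 B2 c sigma y' zb xb
              + (2^-1 * snorm T1 (y' - y) ^+ 2)%:E)%E = [set yb]] <->
  resolvent M T (M (y, z, x)) (yb, zb, xb).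
Proof.
have [a1 a1_gt0 a1P] := coercive1; have [a2 a2_gt0 a2P] := coercive2.
have argmin_z z' : argmin (fun z' => aug_lagrangian (cst 0%E) f2 B1 B2 c sigma
      y z' x + (2^-1 * snorm T2 (z' - z) ^+ 2)%:E)%E z' <->
    subdiff f2 z' (T2 z - adjoint B2 (x + sigma *: (B1 y - c)) - Q2 z').
  rewrite -(argmin_prox B2 sigma_gt0 T2adj T2_ge0) //.
  rewrite [X in argmin X](_ : _ = fun v => (f2 v +
    (prox_quadratic B2 sigma T2 x (B1 y - c) z v)%:E)%E) //; apply/funext => v.
  rewrite /aug_lagrangian /prox_quadratic add0e -addeA -EFinD.
  by rewrite [B2 v + _]addrC [B1 y - c + _]addrAC.
have argmin_y y' : edom f2 zb ->
    argmin (fun y' => aug_lagrangian f1 f2 B1 B2 c sigma y' zb xb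
      + (2^-1 * snorm T1 (y' - y) ^+ 2)%:E)%E y' <->
    subdiff f1 y' (T1 y - adjoint B1 (xb + sigma *: (B2 zb - c)) - Q1 y').
  move=> f2zb; rewrite -(argmin_prox B1 sigma_gt0 T1adj T1_ge0) //.
  (* The summand [f2 zb] is a finite constant, so it can be added without moving the minimizers. *)
  rewrite -[X in _ <-> X y'](argminDr _ (fine (f2 zb))) (proper_fineK f2prop f2zb).
  rewrite [X in argmin X](_ : _ = fun v => (f1 v +
    (prox_quadratic B1 sigma T1 xb (B2 zb - c) y v)%:E + f2 zb)%E) //.
  apply/funext => v; rewrite /aug_lagrangian /prox_quadratic.
  by rewrite -addeA -EFinD addeAC [B1 v + (_ - _)]addrA.
rewrite /= resolventE; set A2 := argmin _; set A1 := argmin _.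
have v3E : sigma *: (B1 y + sigma^-1 *: x - c + B2 zb) =
    x + sigma *: (B1 y + B2 zb - c).
  rewrite -[in RHS](scale1r x) -(divff (lt0r_neq0 sigma_gt0)) -scalerA.
  by rewrite -scalerDr; congr (_ *: _); apply: edot_inj => w; rewrite !edotE; lra.
have v2E : T2 z - sigma *: adjoint B2 (B1 y + sigma^-1 *: x - c) =
    T2 z - adjoint B2 (x + sigma *: (B1 y - c)).
  rewrite -linearZ /= !scalerDr scalerA divff ?lt0r_neq0 // scale1r.
  by congr (_ - adjoint B2 _); apply: edot_inj => w; rewrite !edotE; lra.
(* One of the two copies of [xb] is expanded by the multiplier update; this removes [adjoint B1 x]
   and the penalty term in [B1 y]. *)
have v1E : xb = x + sigma *: (B1 y + B2 zb - c) ->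
    sigma *: adjoint B1 (B1 y) + T1 y + adjoint B1 x - 2 *: adjoint B1 xb =
    T1 y - adjoint B1 (xb + sigma *: (B2 zb - c)).
  by move=> ->; apply: edot_inj => w; rewrite !edotE -!adjointP !edotE; lra.
rewrite v2E v3E; split=> [[A2E xbE A1E]|[xbE s2 s1]].
  have /argmin_z s2 : A2 zb by rewrite A2E.
  have /(argmin_y _ (subdiff_edom f2prop s2)) s1 : A1 yb by rewrite A1E.
  by split=> //; rewrite v1E.
have s2_edom := subdiff_edom f2prop s2; rewrite v1E // in s1.
split=> //; apply/seteqP.
  split=> [z' /argmin_z s2' /=|_ ->]; last exact/argmin_z.
  by have := subdiff_shift_unique f2prop Sigma2P a2_gt0 a2P s2' s2.
split=> [y' /(argmin_y _ s2_edom) s1'|_ ->]; last exact/argmin_y.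
by have := subdiff_shift_unique f1prop Sigma1P a1_gt0 a1P s1' s1.
Qed.

End Resolvent.

(** * Equality of the two relaxed iterations *)

Lemma relaxed_iteration_unique (R : realType) (U : euclideanType R) (J : U -> U)
    (rho : nat -> R) (w0 : U) :
  exists w wb : nat -> U, forall v vb : nat -> U,
    (v 0%N = w0 /\ forall k, vb k = J (v k) /\
      v k.+1 = (1 - rho k) *: v k + rho k *: vb k) <-> v = w /\ vb = wb.
Proof.
pose w := fix w k := if k is n.+1 then
  (1 - rho n) *: w n + rho n *: J (w n) else w0.
exists w, (fun k => J (w k)) => v vb; split=> [[v0 vP]|[-> ->]]; last by [].
have vw k : v k = w k.
  by elim: k => [//|k IH]; rewrite (vP k).2 (vP k).1 /= IH.
by split; apply/funext => k //; rewrite (vP k).1 vw.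
Qed.

Theorem proposition3p2 (R : realType) (Y Z X : euclideanType R)
    (f1 : Y -> \bar R) (f2 : Z -> \bar R)
    (hf1 : proper_fun f1 /\ closed_fun f1 /\ convex_fun f1)
    (hf2 : proper_fun f2 /\ closed_fun f2 /\ convex_fun f2)
    (B1 : 'Hom(Y, X)) (B2 : 'Hom(Z, X)) (c : X)
    (T1 : 'End(Y)) (T2 : 'End(Z))
    (hT1 : self_adjoint T1 /\ pos_semidef T1)
    (hT2 : self_adjoint T2 /\ pos_semidef T2)
    (Sigma1 : 'End(Y)) (Sigma2 : 'End(Z))
    (hSigma1 : convexity_operator f1 Sigma1)
    (hSigma2 : convexity_operator f2 Sigma2)
    (sigma : R) (hsigma : 0 < sigma)
    (hpd1 : pos_def (Sigma1 + (adjoint B1 \o B1)%VF + T1))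
    (hpd2 : pos_def (Sigma2 + (adjoint B2 \o B2)%VF + T2)) :
  let M := M_op sigma B1 T1 T2 in
  let T := T_op f1 f2 B1 B2 c in
  [/\ forall (w0 : Y * Z * X) (rho : nat -> R),
        (forall k, 0 < rho k <= 2) ->
        exists w wb : nat -> Y * Z * X,
          (forall v vb, pADMM f1 f2 B1 B2 c sigma T1 T2 rho w0 v vb
                        <-> v = w /\ vb = wb) /\
          (forall v vb, dPPM M T rho w0 v vb <-> v = w /\ vb = wb),
      admissible_preconditioner M T &
      lipschitz_op (resolvent M T)].
Proof.
move=> M T.
have [p1 [c1 k1]] := hf1; have [p2 [c2 k2]] := hf2.
have [T1adj T1_ge0] := hT1; have [T2adj T2_ge0] := hT2.
have full := resolvent_full c hsigma p1 p2 c1 c2 k1 k2 T1adj T2adj T1_ge0 T2_ge0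
  hSigma1 hSigma2 hpd1 hpd2; rewrite -/M -/T in full.
have single := resolvent_single_valued (c := c) hsigma p1 p2 T1_ge0 T2_ge0
  hSigma1 hSigma2 hpd1 hpd2; rewrite -/M -/T in single.
have lipschitz := resolvent_lipschitz c hsigma p1 p2 T1_ge0 T2_ge0
  hSigma1 hSigma2 hpd1 hpd2; rewrite -/M -/T in lipschitz.
(* Single-valuedness makes the chosen [J] the only selection, so membership in the resolvent at
   [M w] becomes the equation [wb = J w]. *)
have [J JP] := choice (fun w => full (M w)).
have JE w wb : resolvent M T (M w) wb <-> wb = J w.
  by split=> [/single|->]; [apply|exact: JP].
have admmE := admm_stepE c hsigma p1 p2 k1 k2 T1adj T2adj T1_ge0 T2_ge0
  hSigma1 hSigma2 hpd1 hpd2.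
split.
(* Both schemes reduce to the same recursion driven by [J], whose trajectory from [w0] exists and is
   unique. *)
- move=> w0 rho _; have [w [wb wP]] := relaxed_iteration_unique J rho w0.
  exists w, wb; split=> v vb; rewrite -wP; split=> -[v0 vP]; split=> // k.
  + have := vP k; rewrite -JE.
    case: (v k) => [[y z] x]; case: (vb k) => [[yb zb] xb] [A2E xbE A1E vS].
    by split=> //; apply/admmE.
  + have := vP k; rewrite -JE.
    case: (v k) => [[y z] x]; case: (vb k) => [[yb zb] xb] [res vS].
    by have /admmE[A2E xbE A1E] := res.
  + by have [resE vS] := vP k; split=> //; apply/JE; rewrite resE.
  + have [vbE vS] := vP k; split=> //; apply/seteqP; split=> [u /JE ->|_ ->].
      by rewrite vbE.
    exact/JE.
- split.
  + exact: M_op_linear.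
  + exact: M_op_bounded.
  + exact: M_op_self_adjoint.
  + exact: M_op_ge0.
  + by split=> [v|v]; [exact: single|exact: full].
- by split.
Qed.
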